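(* The set of attainable even concordance signatures of equiconcordant copulas, $\{\boldsymbol{\kappa}(C): C \text{ an equiconcordant } d\text{-dimensional copula}\}$, is equal to $$\left\{ \sum_{k=1}^{2^{d-1}} w_k \boldsymbol{a}_k : w_k \geq 0,\ \sum_{k=1}^{2^{d-1}}w_k = 1,\ w_k = w_l\text{ if }\eta_k = \eta_l,\ \forall k,l \in\{1,\ldots,2^{d-1}\} \right\},$$ which can be written as $$\left\{ \sum_{i=1}^{m(d)} v_i \boldsymbol{b}_i : v_i \geq 0,\ \sum_{i=1}^{m(d)} v_i = 1\right\},\qquad \boldsymbol{b}_i = \frac{1}{\mu_i}\sum_{k=1}^{2^{d-1}} \boldsymbol{a}_k \mathbf{1}_{\{\eta_k = h_i\}}.$$ The vectors $\boldsymbol{b}_1,\ldots,\boldsymbol{b}_{m(d)}$ are linearly independent, and the set is a convex polytope with vertices $\boldsymbol{b}_1,\ldots,\boldsymbol{b}_{m(d)}$.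
   Context: Let $d \ge 2$ and $\mathcal{D} = \{1,\ldots,d\}$. A $d$-dimensional copula is a distribution function on $[0,1]^d$ with standard uniform margins. $\mathcal{E}(\mathcal{D})$ is the collection of all subsets of $\mathcal{D}$ of even cardinality, including $\emptyset$. Concordance probabilities: let $C$ be a copula, $\boldsymbol{U}\sim C$ and $\boldsymbol{U}^*$ an independent copy. For $I\subseteq\mathcal{D}$, $\boldsymbol{U}_I$ is the subvector with indices in $I$ and $C_I$ its distribution function. For $|I|\ge 2$, $\kappa_I=\kappa(C_I) = \mathbb{P}(\{\boldsymbol{U}_I \le \boldsymbol{U}_I^*\}\cup\{\boldsymbol{U}_I^*\le \boldsymbol{U}_I\})$ (componentwise inequalities); $\kappa_I = 1$ when $|I|\le 1$. The even concordance signature of $C$ is $\boldsymbol{\kappa}(C) = (\kappa(C_I): I\in\mathcal{E}(\mathcal{D}))$. A copula is equiconcordant if $\kappa_I=\kappa_{\tilde I}$ for all $I,\tilde I\in\mathcal{E}(\mathcal{D})$ with $|I|=|\tilde I|$. For $k\in\{1,\ldots,2^{d-1}\}$ let $\boldsymbol{s}_k\in\{0,1\}^d$ be the vector of digits of $k-1$ written as a $d$-digit binary number, $J_k=\{j\in\mathcal{D}: s_{k,j}=0\}$ and $J_k^\complement = \mathcal{D}\setminus J_k$. Let $a_{I,k}=1$ if $I\subseteq J_k$ or $I\subseteq J_k^\complement$, and $a_{I,k}=0$ otherwise, and $\boldsymbol{a}_k=(a_{I,k}: I\in\mathcal{E}(\mathcal{D}))$. Let $\eta_k=\max(|J_k|,|J_k^\complement|)$.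 The distinct values of $\eta_k$ ordered from largest to smallest are $(h_1,\ldots,h_{m(d)}) = (d,d-1,\ldots,\lceil d/2\rceil)$ with $m(d)=1+\lfloor d/2\rfloor$, and $\mu_i$ is the number of $k\in\{1,\ldots,2^{d-1}\}$ with $\eta_k=h_i$. *)

(* Defs.v *)
From HB Require Import structures.
From mathcomp Require Import all_boot all_order all_algebra.
From mathcomp Require Import all_classical all_reals all_analysis.
From mathcomp Require Import measurable_realfun.
Set Implicit Arguments.
Unset Strict Implicit.
Unset Printing Implicit Defensive.
Import Order.TTheory GRing.Theory Num.Theory.
Local Open Scope classical_set_scope.
Local Open Scope ring_scope.

(* Indices are 0-based: [j : 'I_d] stands for the element j + 1 of {1, ..., d}
   and [k : 'I_(2 ^ d.-1)] for the element k + 1 of {1, ..., 2^(d-1)}. *)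

Notation even_set d := {I : {set 'I_d} | ~~ odd #|I|}.

(* [R^o] is [R] seen as a vector space over itself; it makes the families
   indexed by the even subsets a finite-dimensional vector space. *)
Notation signature R d := {ffun even_set d -> R^o}.

Definition orthant (R : realType) (d : nat) (u : d.-tuple R) :
    set (d.-tuple R) := [set x | forall j, tnth x j <= tnth u j].

Definition has_cdf (R : realType) (d : nat)
    (mu : probability (d.-tuple R) R) (C : d.-tuple R -> R) : Prop :=
  forall u, mu (orthant u) = (C u)%:E.

Definition uniform_margins (R : realType) (d : nat)
    (mu : probability (d.-tuple R) R) : Prop :=
  forall (j : 'I_d) (A : set R), measurable A ->
    pushforward mu (fun x : d.-tuple R => tnth x j) A =
    uniform_prob (@ltr01 R) A.

(* A copula is extended to R^d as the distribution function of its law, which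
   is carried by the unit cube because of its margins. *)
Definition is_copula (R : realType) (d : nat) (C : d.-tuple R -> R) : Prop :=
  exists mu : probability (d.-tuple R) R, has_cdf mu C /\ uniform_margins mu.

Definition sub_le (R : realType) (d : nat) (I : {set 'I_d})
    (x y : d.-tuple R) : Prop :=
  forall j, j \in I -> tnth x j <= tnth y j.

Definition concordant (R : realType) (d : nat) (I : {set 'I_d}) :
    set (d.-tuple R * d.-tuple R) :=
  [set p | sub_le I p.1 p.2] `|` [set p | sub_le I p.2 p.1].

Arguments concordant R {d} I.

(* Under [mu \x mu] the two coordinates are U and its independent copy. *)
Definition law_kappa (R : realType) (d : nat)
    (mu : probability (d.-tuple R) R) (I : {set 'I_d}) : R :=
  if (#|I| <= 1)%N then 1 else fine ((mu \x mu)%E (concordant R I)).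

(* Well defined: two laws with the same distribution function are equal; see
   [kappaE] below. *)
Definition kappa (R : realType) (d : nat) (C : d.-tuple R -> R)
    (I : {set 'I_d}) : R :=
  xget 0 [set r | exists2 mu : probability (d.-tuple R) R,
                    has_cdf mu C & r = law_kappa mu I].

Lemma tuple_ub (R : realType) (d : nat) (x : d.-tuple R) :
  exists n : nat, forall j, tnth x j <= n%:R.
Proof.
exists (\max_j Num.bound `|tnth x j|)%N => j.
apply: (le_trans (ler_norm _)); apply: ltW.
apply: (lt_le_trans (archi_boundP (normr_ge0 _))).
by rewrite ler_nat (bigD1 j) //= leq_maxl.
Qed.

Lemma measurable_tuple_orthant (R : realType) (d : nat) :
  @measurable _ (d.-tuple R) = <<s range (@orthant R d) >>.
Proof.
rewrite eqEsubset; split.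
  apply: smallest_sub; first exact: smallest_sigma_algebra.
  rewrite -bigcup_seq => A [i _] [B mB <-].
  suff : preimage_set_system setT (fun x : d.-tuple R => tnth x i)
           (@measurable _ R) `<=` <<s range (@orthant R d) >>.
    by apply; exists B.
  have -> : preimage_set_system setT (fun x : d.-tuple R => tnth x i)
      (@measurable _ R) = <<s preimage_set_system setT
        (fun x : d.-tuple R => tnth x i) (@RGenOInfty.G R) >>.
    rewrite (@g_sigma_preimageE _ (measurableTypeR R) setT (fun x : d.-tuple R => tnth x i)).
    by rewrite -RGenOInfty.measurableE.
  apply: smallest_sub; first exact: smallest_sigma_algebra.
  move=> _ [_ [r ->] <-]; rewrite setTI.
  have -> : (fun x : d.-tuple R => tnth x i) @^-1` `]r, +oo[ =
      ~` \bigcup_n orthant [tuple if j == i then r else n%:R | j < d].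
    apply/seteqP; split => x /=.
      rewrite in_itv /= andbT => rx [n _] /(_ i).
      by rewrite tnth_mktuple eqxx leNgt rx.
    move=> nx; rewrite in_itv /= andbT ltNge; apply/negP => xr; apply: nx.
    have [n xn] := tuple_ub x.
    by exists n => // j; rewrite tnth_mktuple; case: eqP => [->|].
  have [_ cC cU] := smallest_sigma_algebra [set: d.-tuple R] (range (@orthant R d)).
  rewrite -setTD; apply: cC; apply: cU => n.
  by apply: sub_sigma_algebra; exists [tuple if j == i then r else n%:R | j < d].
apply: smallest_sub; first exact: sigma_algebra_measurable.
move=> _ [u _ <-].
have -> : orthant u = \bigcap_(j in [set: 'I_d])
    (fun x : d.-tuple R => tnth x j) @^-1` `]-oo, tnth u j].
  apply/seteqP; split => x /= xu j; first by move=> _; rewrite /= in_itv /=.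
  by have := xu j Logic.I; rewrite /= in_itv.
apply: fin_bigcap_measurable => // j _.
by rewrite -[X in measurable X]setTI; apply: measurable_tnth.
Qed.

Lemma has_cdf_unique (R : realType) (d : nat) (C : d.-tuple R -> R)
    (mu nu : probability (d.-tuple R) R) :
  has_cdf mu C -> has_cdf nu C -> forall A, measurable A -> mu A = nu A.
Proof.
move=> muC nuC A mA.
apply: (measure_unique (range (@orthant R d))
          (fun n => orthant [tuple n%:R | j < d])) => //.
- exact: measurable_tuple_orthant.
- move=> _ _ [u _ <-] [v _ <-].
  exists [tuple Num.min (tnth u j) (tnth v j) | j < d] => //.
  apply/seteqP; split => x /=.
    move=> xuv; split => j; have := xuv j; rewrite tnth_mktuple le_min.
      by case/andP.
    by case/andP.
  by move=> [xu xv] j; rewrite tnth_mktuple le_min xu xv.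
- rewrite -subTset => x _.
  by have [n xn] := tuple_ub x; exists n => // j; rewrite tnth_mktuple.
- by move=> _ [u _ <-]; exact: etrans (muC u) (esym (nuC u)).
- by move=> n; exact: (eq_ind_r (fun z => (z < +oo)%E) (ltry _) (muC _)).
Qed.

Lemma measurable_concordant (R : realType) (d : nat) (I : {set 'I_d}) :
  measurable (concordant R I).
Proof.
have mle (f g : d.-tuple R * d.-tuple R -> d.-tuple R) :
    measurable_fun setT f -> measurable_fun setT g ->
    measurable [set p | sub_le I (f p) (g p)].
  move=> mf mg.
  have -> : [set p | sub_le I (f p) (g p)] =
      \bigcap_(j in [set` I]) [set p | tnth (f p) j <= tnth (g p) j].
    by apply/seteqP; split => p /= pI j; exact: pI.
  apply: fin_bigcap_measurable => // j _.
  rewrite -[X in measurable X]setTI.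
  by apply: measurable_fun_le => //;
    apply: (measurableT_comp (@measurable_tnth _ _ _ j)).
by apply: measurableU; apply: mle.
Qed.

Lemma kappaE (R : realType) (d : nat) (C : d.-tuple R -> R)
    (mu : probability (d.-tuple R) R) (I : {set 'I_d}) :
  has_cdf mu C -> kappa C I = law_kappa mu I.
Proof.
move=> muC; rewrite /kappa.
case: xgetP => [_ -> [nu nuC ->]|/(_ (law_kappa mu I)) []]; last by exists mu.
rewrite /law_kappa; case: ifP => // _; congr fine.
have numu := has_cdf_unique nuC muC.
apply: product_measure_unique; last exact: measurable_concordant.
move=> A B mA mB; apply: (etrans (product_measure1E _ _ mA mB)).
exact: (congr2 mule (esym (numu A mA)) (esym (numu B mB))).
Qed.

Definition even_signature (R : realType) (d : nat) (C : d.-tuple R -> R) :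
    signature R d :=
  [ffun I => kappa C (val I)].

Definition equiconcordant (R : realType) (d : nat) (C : d.-tuple R -> R) :
    Prop :=
  forall I I' : even_set d, #|val I| = #|val I'| ->
    kappa C (val I) = kappa C (val I').

(* Digit j (the most significant one for j = 0) of k as a d-digit binary
   number. *)
Definition digit (d : nat) (k : 'I_(2 ^ d.-1)) (j : 'I_d) : bool :=
  odd (k %/ 2 ^ (d - j.+1)).

Definition Jset (d : nat) (k : 'I_(2 ^ d.-1)) : {set 'I_d} :=
  [set j | ~~ digit k j]%SET.

Definition avec (R : realType) (d : nat) (k : 'I_(2 ^ d.-1)) : signature R d :=
  [ffun I : even_set d =>
     ((val I \subset Jset k) || (val I \subset (~: Jset k)%SET))%:R : R^o].

Definition eta (d : nat) (k : 'I_(2 ^ d.-1)) : nat :=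
  maxn #|Jset k| #|(~: Jset k)%SET|.

Definition msize (d : nat) : nat := (1 + d./2)%N.

(* (h_1, ..., h_m) = (d, d - 1, ..., ceil (d / 2)). *)
Definition hval (d : nat) (i : 'I_(msize d)) : nat := (d - i)%N.

Definition multiplicity (d : nat) (i : 'I_(msize d)) : nat :=
  #|[set k : 'I_(2 ^ d.-1) | eta k == hval i]%SET|.

Definition bvec (R : realType) (d : nat) (i : 'I_(msize d)) : signature R d :=
  (multiplicity i)%:R^-1 *: \sum_(k < 2 ^ d.-1) (eta k == hval i)%:R *: avec R k.

Definition attainable_equiconcordant (R : realType) (d : nat) :
    set (signature R d) :=
  [set x | exists C : d.-tuple R -> R,
             [/\ is_copula C, equiconcordant C & x = even_signature C]].

Definition eta_invariant_mixtures (R : realType) (d : nat) :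
    set (signature R d) :=
  [set x | exists w : 'I_(2 ^ d.-1) -> R,
             [/\ forall k, 0 <= w k, \sum_k w k = 1,
                 forall k l, eta k = eta l -> w k = w l
               & x = \sum_k w k *: avec R k]].

Definition b_mixtures (R : realType) (d : nat) : set (signature R d) :=
  [set x | exists v : 'I_(msize d) -> R,
             [/\ forall i, 0 <= v i, \sum_i v i = 1
               & x = \sum_i v i *: bvec R i]].

Arguments attainable_equiconcordant R d : clear implicits.
Arguments eta_invariant_mixtures R d : clear implicits.
Arguments b_mixtures R d : clear implicits.

Definition convex_hull (R : realType) (V : lmodType R) (A : set V) : set V :=
  smallest (@convex_set R V) A.

Definition convex_polytope (R : realType) (V : lmodType R) (S : set V) : Prop :=
  exists2 A : set V, finite_set A & S = convex_hull A.

(* Vertices are taken as extreme points. *)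
Definition vertices (R : realType) (V : lmodType R) (S : set V) : set V :=
  [set x | S x /\ forall (y z : V) (t : R), S y -> S z -> 0 < t < 1 ->
             x = t *: y + (1 - t) *: z -> y = x /\ z = x].

(* Main.v *)
From HB Require Import structures.
Require Import Defs.
From mathcomp Require Import all_boot all_order all_algebra all_fingroup.
From mathcomp Require Import zify ring lra.
From mathcomp Require Import all_classical all_reals all_analysis.
From mathcomp Require Import measurable_realfun.
Set Implicit Arguments.
Unset Strict Implicit.
Unset Printing Implicit Defensive.
Import Order.TTheory GRing.Theory Num.Theory.
Local Open Scope classical_set_scope.
Local Open Scope ring_scope.

(** Let U, U' be independent copies with a copula as distribution function and
let J be the random set of the coordinates j with U_j < U'_j.  Uniform margins
have no atoms, so ties are negligible and U_I, U'_I are concordant exactly when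
I lies in J or in the complement of J ([concordant_pattern]).  Hence every
signature is a convex combination of the vectors a_k, the weight of a_k being
the probability that J is J_k or its complement ([law_kappa_pattern]).  If the
copula is equiconcordant, averaging these weights over all permutations of the
coordinates does not change the signature, and the averaged weight of a_k
depends on the sizes of J_k and of its complement only, that is, on eta_k
([symmetrized_weights]).

Conversely, given weights w_k, draw k with probability w_k, draw x uniformly in
[0, 1] and let U_j be x for j in J_k and 1 - x otherwise.  The margins are
uniform.  For two independent draws (k, x) and (l, y), the draw that is farther
from the centre 1/2 decides alone in which order all the coordinates stand:
if it is the first one, U_I and U'_I are concordant exactly when a_{I,k} = 1
([concordant_dominant]).  Both draws have the same law, so whichever dominates,
the conditional probability of concordance is the sum of the w_k a_{I,k}
([mixture_law]).

It remains to study the polytope.  Grouping the indices k by the value of eta_k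
turns the mixtures with weights depending on eta_k into the mixtures of the b_i.
The a_k are linearly independent ([avec_free]): a linear relation between them
is a function u of the sets of indices, invariant under complement, whose sums over
the supersets of I vanish for all I of even size.  By inclusion-exclusion the
sum for an I of odd size is minus itself up to sums for smaller sets, so all
these sums vanish, and so does u.  The b_i are normalized sums of the a_k over
disjoint nonempty sets of indices, so they are linearly independent too.  Finally
the convex hull of a finite linearly independent family has this family as its
set of extreme points ([vertices_mixtures]). *)

(** * Splits of the index set *)

Definition same_side (d : nat) (I J : {set 'I_d}) : bool :=
  (I \subset J) || (I \subset ~: J)%SET.

Lemma same_sideC (d : nat) (I J : {set 'I_d}) :
  same_side I (~: J)%SET = same_side I J.
Proof. by rewrite /same_side finset.setCK orbC. Qed.

Lemma same_side_small (d : nat) (I J : {set 'I_d}) :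
  (#|I| <= 1)%N -> ~~ odd #|I| -> same_side I J.
Proof.
move=> I1 evI; have -> : I = finset.set0.
  by apply: cards0_eq; move: I1 evI; case: #|I| => [|[]].
by rewrite /same_side finset.sub0set.
Qed.

Lemma avecE (R : realType) (d : nat) (k : 'I_(2 ^ d.-1)) (I : even_set d) :
  avec R k I = (same_side (val I) (Jset k))%:R.
Proof. by rewrite ffunE. Qed.

Lemma binary_digits_inj (n a b : nat) :
  (a < 2 ^ n)%N -> (b < 2 ^ n)%N ->
  (forall i, (i < n)%N -> odd (a %/ 2 ^ i) = odd (b %/ 2 ^ i)) -> a = b.
Proof.
elim: n a b => [|n IHn] a b; first by rewrite expn0 !ltnS !leqn0 => /eqP-> /eqP->.
move=> an bn ab.
have ab0 := ab 0 isT; rewrite expn0 !divn1 in ab0.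
rewrite -(odd_double_half a) -(odd_double_half b) ab0; congr (_ + _.*2)%N.
apply: IHn => [||i ni]; rewrite -!divn2.
- by rewrite ltn_divLR // -expnSr.
- by rewrite ltn_divLR // -expnSr.
- by rewrite -!divnMA -expnS; exact: ab.
Qed.

(** The sets J_k are the subsets that contain the first index, since the leading
digit of a number below 2^(d-1) is 0.  So exactly one of J and its complement is
some J_k, and a sum over all subsets is a sum over the J_k and their
complements. *)
Section Splits.
Variable n : nat.
Local Notation d := n.+1.
Implicit Types (k l : 'I_(2 ^ d.-1)) (I J : {set 'I_d}).

Lemma Jset_inj : injective (@Jset d).
Proof.
move=> k l kl; apply: val_inj; apply: (@binary_digits_inj n) => // [||i ni].
- exact: ltn_ord.
- exact: ltn_ord.
have id : (n - i < d)%N by rewrite ltnS leq_subr.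
have /setP /(_ (Ordinal id)) := kl.
rewrite !inE /digit /= subSS subKn; last exact: ltnW.
by move/negb_inj.
Qed.

Lemma ord0_in_Jset k : ord0 \in Jset k.
Proof.
rewrite inE /digit /= subSS subn0 divn_small //; exact: ltn_ord.
Qed.

Lemma Jset_image : [set Jset k | k : 'I_(2 ^ d.-1)]%SET = [set J : {set 'I_d} | ord0 \in J]%SET.
Proof.
apply/eqP; rewrite eqEcard; apply/andP; split.
  by apply/fintype.subsetP => _ /imsetP[k _ ->]; rewrite inE ord0_in_Jset.
rewrite card_imset ?card_ord; last exact: Jset_inj.
have C : [set J : {set 'I_d} | ord0 \notin J]%SET =
    [set (~: (J : {set 'I_d}))%SET | J in [set J : {set 'I_d} | ord0 \in J]%SET]%SET.
  apply/setP => J; apply/idP/imsetP.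
    by rewrite inE => J0; exists (~: J)%SET; rewrite ?inE // finset.setCK.
  by case=> K; rewrite !inE => K0 ->; rewrite inE K0.
have := finset.cardsC [set J : {set 'I_d} | ord0 \in J]%SET.
have -> : (~: [set J : {set 'I_d} | ord0 \in J])%SET =
    [set J : {set 'I_d} | ord0 \notin J]%SET by apply/setP => J; rewrite !inE.
rewrite C card_imset; last exact: finset.setC_inj.
rewrite addnn -cardsT -powersetT card_powerset cardsT card_ord /= expnS mul2n => /double_inj ->.
by [].
Qed.

Lemma sum_Jset (V : nmodType) (f : {set 'I_d} -> V) :
  \sum_J f J = \sum_k (f (Jset k) + f (~: Jset k)%SET).
Proof.
have pos (g : {set 'I_d} -> V) :
    \sum_(J : {set 'I_d} | ord0 \in J) g J = \sum_(k : 'I_(2 ^ d.-1)) g (Jset k).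
  transitivity (\sum_(J in [set J : {set 'I_d} | ord0 \in J]%SET) g J).
    by apply: eq_bigl => J; rewrite inE.
  by rewrite -Jset_image big_imset //= => k l _ _; apply: Jset_inj.
rewrite (bigID (fun J : {set 'I_d} => ord0 \in J)) /= big_split /= pos.
congr (_ + _); rewrite -(pos (fun J => f (~: J)%SET)).
rewrite (reindex_inj (@finset.setC_inj _)) /=; apply: eq_bigl => J.
by rewrite inE negbK.
Qed.

Lemma Jset_surj J : exists k, J = Jset k \/ J = (~: Jset k)%SET.
Proof.
have im (K : {set 'I_d}) : ord0 \in K -> exists k, K = Jset k.
  move=> K0; have : K \in [set J : {set 'I_d} | ord0 \in J]%SET by rewrite inE.
  by rewrite -Jset_image => /imsetP[k _ ->]; exists k.
have [/im[k ->]|J0] := boolP (ord0 \in J); first by exists k; left.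
have /im[k Jk] : ord0 \in (~: J)%SET by rewrite inE.
by exists k; right; rewrite -Jk finset.setCK.
Qed.

(** The k for which J is J_k or its complement.  It
extends a family indexed by k to a function of subsets invariant under
complement, on which permutations of the coordinates act. *)
Definition split_index J : 'I_(2 ^ d.-1) := projT1 (cid (Jset_surj J)).

Lemma split_indexP J : J = Jset (split_index J) \/ J = (~: Jset (split_index J))%SET.
Proof. by rewrite /split_index; case: cid. Qed.

Lemma split_indexK k : split_index (Jset k) = k.
Proof.
apply: Jset_inj; have [//|kE] := split_indexP (Jset k).
by have := ord0_in_Jset k; rewrite kE inE ord0_in_Jset.
Qed.

Lemma split_indexC J : split_index (~: J)%SET = split_index J.
Proof.
have CK k : split_index (~: Jset k)%SET = k.
  apply: Jset_inj; have [kE|] := split_indexP (~: Jset k)%SET.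
    by have := ord0_in_Jset (split_index (~: Jset k)%SET); rewrite -kE inE ord0_in_Jset.
  by move/finset.setC_inj.
have [JE|JE] := split_indexP J; rewrite [in LHS]JE; first exact: CK.
by rewrite finset.setCK split_indexK.
Qed.

Lemma eta_split_index J : eta (split_index J) = maxn #|J| #|(~: J)%SET|.
Proof.
rewrite /eta; have [JE|JE] := split_indexP J; rewrite [in RHS]JE //.
by rewrite finset.setCK maxnC.
Qed.

End Splits.

(** * Averaging over permutations *)

Section Permutations.
Variable n : nat.
Local Notation d := n.+1.
Implicit Types (I J : {set 'I_d}) (s : {perm 'I_d}).

(** The indicator sequences of I and J are permutations of one another because
they contain the same number of each boolean. *)
Lemma equicardinal_perm I J : #|I| = #|J| -> exists s, (s @^-1: J)%SET = I.
Proof.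
move=> IJ.
pose t (A : {set 'I_d}) := [tuple i \in A | i < d].
have cnt (A : {set 'I_d}) b : count_mem b (t A) = #|[set i | (i \in A) == b]%SET|.
  rewrite -sum1_count -sum1_card big_map big_enum_cond /=.
  by apply: eq_bigl => i; rewrite inE.
have /tuple_permP[s ts] : perm_eq (t I) (t J).
  apply/allP => b _; apply/eqP; rewrite /= !cnt; case: b.
    have e (A : {set 'I_d}) : #|[set i | (i \in A) == true]%SET| = #|A|.
      by apply: eq_card => i; rewrite inE eqb_id.
    by rewrite !e IJ.
  have e (A : {set 'I_d}) : #|[set i | (i \in A) == false]%SET| = (d - #|A|)%N.
    rewrite -[X in (X - _)%N]card_ord -(finset.cardsC A) addKn.
    by apply: eq_card => i; rewrite !inE eqbF_neg.
  by rewrite !e IJ.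
exists s; apply/setP => i; rewrite inE.
have := congr1 (fun u : seq bool => nth false u i) ts.
by rewrite -!tnth_nth !tnth_mktuple => ->.
Qed.

Lemma perm_preimset_inj s : injective (fun J => (s @^-1: J)%SET).
Proof.
move=> I J /setP IJ; apply/setP => i.
by have := IJ ((s^-1)%g i); rewrite !inE permKV.
Qed.

Lemma same_side_perm s I J : same_side (s @^-1: I)%SET (s @^-1: J)%SET = same_side I J.
Proof.
have sub (A B : {set 'I_d}) : (s @^-1: A \subset s @^-1: B)%SET = (A \subset B).
  apply/fintype.subsetP/fintype.subsetP => AB i; last by rewrite !inE; exact: AB.
  by have := AB ((s^-1)%g i); rewrite !inE permKV.
by rewrite /same_side -preimsetC !sub.
Qed.

(** A permutation need not map some J_k to some J_l, but it maps the pair of J_k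
and its complement to such a pair: both sides are half of the sum of f over all
subsets. *)
Lemma sum_Jset_perm (K : numDomainType) s (f : {set 'I_d} -> K) :
  (forall J, f (~: J)%SET = f J) ->
  \sum_k f (s @^-1: Jset k)%SET = \sum_(k : 'I_(2 ^ d.-1)) f (Jset k).
Proof.
move=> fC; have := sum_Jset f.
rewrite (reindex_inj (@perm_preimset_inj s)) /= (sum_Jset (fun J => f (s @^-1: J)%SET)) /=.
under eq_bigr do rewrite preimsetC fC -mulr2n.
under [in RHS]eq_bigr do rewrite fC -mulr2n.
by rewrite !sumrMnl => /eqP; rewrite eqrMn2r // => /eqP.
Qed.

Lemma eta_invariant_perm (K : Type) (w : 'I_(2 ^ d.-1) -> K) s J :
  (forall k l, eta k = eta l -> w k = w l) ->
  w (split_index (s @^-1: J)%SET) = w (split_index J).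
Proof.
move=> w_eta; apply: w_eta; rewrite !eta_split_index -preimsetC.
by rewrite !(card_preimset _ (@perm_inj _ s)).
Qed.

(** Move I' to I by a permutation; the weights, being functions of eta, do not
see it. *)
Lemma mixture_card_invariant (K : numDomainType) (w : 'I_(2 ^ d.-1) -> K) I I' :
  (forall k l, eta k = eta l -> w k = w l) -> #|I| = #|I'| ->
  \sum_k w k * (same_side I (Jset k))%:R =
  \sum_k w k * (same_side I' (Jset k))%:R.
Proof.
move=> w_eta /equicardinal_perm[s <-].
pose f J := w (split_index J) * (same_side (s @^-1: I')%SET J)%:R.
transitivity (\sum_k f (Jset k)).
  by apply: eq_bigr => k _; rewrite /f split_indexK.
rewrite -(@sum_Jset_perm _ s) => [|J]; last by rewrite /f split_indexC same_sideC.
apply: eq_bigr => k _.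
by rewrite /f same_side_perm eta_invariant_perm // split_indexK.
Qed.

(** The weight of k is the mean of v over the preimages of J_k under all
permutations.  It depends on eta_k only, since sets of the same size are
preimages of one another and v does not distinguish a set from its complement.
It has the same mixtures: moving the permutation from J_k to I replaces I by a
set of the same size, where the mixture is the same by assumption. *)
Lemma symmetrized_weights (K : numFieldType) (v : {set 'I_d} -> K) :
  (forall J, 0 <= v J) -> (forall J, v (~: J)%SET = v J) ->
  (forall I I', ~~ odd #|I| -> #|I| = #|I'| ->
    \sum_k v (Jset k) * (same_side I (Jset k))%:R =
    \sum_(k : 'I_(2 ^ d.-1)) v (Jset k) * (same_side I' (Jset k))%:R) ->
  exists w : 'I_(2 ^ d.-1) -> K,
    [/\ forall k, 0 <= w k, \sum_k w k = \sum_(k : 'I_(2 ^ d.-1)) v (Jset k),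
        forall k l, eta k = eta l -> w k = w l
      & forall I, ~~ odd #|I| ->
          \sum_k v (Jset k) * (same_side I (Jset k))%:R =
          \sum_k w k * (same_side I (Jset k))%:R].
Proof.
move=> v0 vC v_card; pose N : K := #|{perm 'I_d}|%:R.
have N0 : N != 0 by rewrite pnatr_eq0 -lt0n; apply/card_gt0P; exists 1%g.
pose w k := N^-1 * \sum_(s : {perm 'I_d}) v (s @^-1: Jset k)%SET.
have avg (g : 'I_(2 ^ d.-1) -> K) c :
    (forall s : {perm 'I_d}, \sum_k v (s @^-1: Jset k)%SET * g k = c) ->
    \sum_k w k * g k = c.
  move=> gc; under eq_bigr do rewrite -mulrA big_distrl /=.
  rewrite -big_distrr exchange_big /=.
  under eq_bigr do rewrite gc.
  by rewrite sumr_const -[c *+ _]mulr_natl mulKf.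
have avgJ J J' s : (s @^-1: J)%SET = J' ->
    \sum_(t : {perm 'I_d}) v (t @^-1: J)%SET = \sum_(t : {perm 'I_d}) v (t @^-1: J')%SET.
  move=> <-; rewrite (reindex_inj (mulIg s)) /=; apply: eq_bigr => t _.
  by congr v; apply/setP => i; rewrite !inE permM.
exists w; split.
- by move=> k; rewrite mulr_ge0 ?invr_ge0 ?ler0n // sumr_ge0.
- under eq_bigr do rewrite -[w _]mulr1.
  apply: avg => s; under eq_bigr do rewrite mulr1.
  exact: sum_Jset_perm.
- move=> k l kl; congr (_ * _).
  have [kl'|kl'] : #|Jset k| = #|Jset l| \/ #|Jset k| = #|(~: Jset l)%SET|.
    have := finset.cardsC (Jset k); have := finset.cardsC (Jset l).
    move: kl; rewrite /eta; lia.
  + by have [s sJ] := equicardinal_perm (esym kl'); apply: avgJ sJ.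
  + have [s sJ] := equicardinal_perm (esym kl').
    rewrite (avgJ _ _ _ sJ); apply: eq_bigr => t _.
    by rewrite preimsetC vC.
- move=> I evI; apply/esym/avg => s.
  rewrite (v_card I (s @^-1: I)%SET evI); last first.
    by rewrite card_preimset //; exact: perm_inj.
  rewrite -(@sum_Jset_perm _ s (fun J => v J * (same_side (s @^-1: I)%SET J)%:R)).
    by apply: eq_bigr => k _; rewrite same_side_perm.
  by move=> J; rewrite vC same_sideC.
Qed.

End Permutations.

(** * Linear independence of the vectors a_k *)

Section Independence.
Variable n : nat.
Local Notation d := n.+1.
Implicit Types (I J : {set 'I_d}).

(** The system is triangular: by descending induction on the size of J, the
equation for I = J reduces to its term in J. *)
Lemma subset_sum0 (K : nzRingType) (u : {set 'I_d} -> K) :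
  (forall I, \sum_J u J * (I \subset J)%:R = 0) -> forall J, u J = 0.
Proof.
move=> u0 J; have [m] := ubnP (d - #|J|)%N; elim: m J => // m IHm J Jm.
have := u0 J; rewrite (bigD1 J) //= fintype.subxx mulr1 big1 ?addr0 // => L LJ.
have [JL|] := boolP (J \subset L); last by rewrite mulr0.
rewrite IHm ?mul0r //.
have /proper_card JL' : J \proper L by rewrite finset.properEneq eq_sym LJ.
have : (#|L| <= d)%N by rewrite -[X in (_ <= X)%N]card_ord max_card.
lia.
Qed.

(** Expand the product over i of (1 - [i in I and i in J]), which is 1 if and
only if I avoids J. *)
Lemma inclusion_exclusion (K : comNzRingType) I J :
  (I \subset ~: J)%SET%:R =
  \sum_(L : {set 'I_d} | L \subset I) (-1) ^+ #|L| * (L \subset J)%:R :> K.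
Proof.
transitivity (\prod_i (- ((i \in I) && (i \in J))%:R + 1) : K).
  have [sIJ|/fintype.subsetPn[i iI]] := boolP (I \subset ~: J)%SET.
    rewrite big1 // => i _; case: andP => [[/(fintype.subsetP sIJ)]|]; last first.
      by rewrite oppr0 add0r.
    by rewrite inE => /negbTE ->.
  by rewrite inE negbK => iJ; rewrite (bigD1 i) //= iI iJ addNr mul0r.
rewrite bigA_distr [RHS]big_mkcond /=; apply: eq_bigr => L _.
rewrite -big_mkcond /= prodrN; have [LI|/fintype.subsetPn[i iL iI]] := boolP (L \subset I).
  congr (_ * _); have [LJ|/fintype.subsetPn[i iL iJ]] := boolP (L \subset J).
    by apply: big1 => i iL; rewrite (fintype.subsetP LI) ?(fintype.subsetP LJ).
  by rewrite (bigD1 i) //= (negbTE iJ) andbF mul0r.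
by rewrite (bigD1 i) //= (negbTE iI) mul0r mulr0.
Qed.

(** By [subset_sum0] it suffices to treat the sums S(I) for I of odd size.  By
the invariance under complement, S(I) is also the sum of u over the sets that
avoid I, which is the sum of (-1)^|L| S(L) over the subsets L of I.  The proper
subsets contribute 0 by induction, and L = I contributes - S(I). *)
Lemma even_sum0 (K : numDomainType) (u : {set 'I_d} -> K) :
  (forall J, u (~: J)%SET = u J) ->
  (forall I, ~~ odd #|I| -> \sum_J u J * (I \subset J)%:R = 0) ->
  forall J, u J = 0.
Proof.
move=> uC u_even; apply: subset_sum0 => I.
have [m] := ubnP #|I|; elim: m I => // m IHm I Im.
have [oI|] := boolP (odd #|I|); last exact: u_even.
set S := LHS.
have SE : S = \sum_(L : {set 'I_d} | L \subset I) (-1) ^+ #|L| *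
    \sum_J u J * (L \subset J)%:R.
  rewrite /S (reindex_inj (@finset.setC_inj _)) /=.
  under eq_bigr do rewrite uC inclusion_exclusion big_distrr /=.
  rewrite exchange_big /=; apply: eq_bigr => L _.
  by rewrite big_distrr /=; apply: eq_bigr => J _; rewrite mulrCA.
rewrite (bigD1 I) //= [X in _ + X]big1 ?addr0 in SE; last first.
  move=> L /andP[LI LnI]; rewrite IHm ?mulr0 //.
  have /proper_card : L \proper I by rewrite finset.properEneq LnI.
  lia.
move: SE; rewrite -/S -signr_odd oI expr1 mulN1r => /eqP.
by rewrite -addr_eq0 -mulr2n mulrn_eq0 => /eqP.
Qed.

Lemma avec_free (R : realType) (c : 'I_(2 ^ d.-1) -> R) :
  \sum_k c k *: avec R k = 0 -> forall k, c k = 0.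
Proof.
move=> c0; pose u J := c (split_index J).
suff u0 J : u J = 0 by move=> k; rewrite -(split_indexK k) -/(u _) u0.
have uC K : u (~: K)%SET = u K by rewrite /u split_indexC.
apply: (even_sum0 uC) => I evI.
have uS0 : \sum_K u K * (same_side I K)%:R = 0.
  rewrite (sum_Jset (fun K => u K * (same_side I K)%:R)).
  under eq_bigr do rewrite uC same_sideC -mulr2n /u split_indexK.
  rewrite sumrMnl; have := congr1 (fun f : signature R d => f (exist _ I evI)) c0.
  rewrite sum_ffunE ffunE => c0'.
  rewrite (_ : \sum_k _ = 0) ?mul0rn // -[RHS]c0'.
  by apply: eq_bigr => k _; rewrite [in RHS]ffunE avecE.
have [I0|[i iI]] := finset.set_0Vmem I.
  rewrite -[RHS]uS0; apply: eq_bigr => K _.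
  by rewrite /same_side I0 !finset.sub0set.
have SC : \sum_K u K * (I \subset K)%:R = \sum_K u K * (I \subset ~: K)%SET%:R.
  rewrite (reindex_inj (@finset.setC_inj _)) /=.
  by apply: eq_bigr => K _; rewrite uC.
apply/eqP; rewrite -[_ == 0](@mulrn_eq0 _ _ 2) mulr2n {2}SC -big_split /=.
rewrite -[X in _ == X]uS0; apply/eqP/eq_bigr => K _; rewrite -mulrDr; congr (_ * _).
rewrite /same_side; case: (boolP (I \subset K)) => [IK|_]; last by rewrite add0r.
case: (boolP (I \subset ~: K)%SET) => [ICK|]; last by rewrite addr0.
by have := fintype.subsetP ICK _ iI; rewrite inE (fintype.subsetP IK).
Qed.

End Independence.

(** * Grouping by the larger part *)

Section Layers.
Variable n : nat.
Local Notation d := n.+1.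
Implicit Types (k l : 'I_(2 ^ d.-1)) (i : 'I_(msize d)).

Lemma layer_proof k : (d - eta k < msize d)%N.
Proof.
have := finset.cardsC (Jset k); rewrite card_ord /eta /msize; lia.
Qed.

(** The index i with h_i = eta_k. *)
Definition layer k : 'I_(msize d) := Ordinal (layer_proof k).

Lemma eta_hval k i : (eta k == hval i) = (layer k == i).
Proof.
have := finset.cardsC (Jset k); rewrite card_ord => kd.
case: i => i; rewrite /msize => im.
rewrite -[RHS](inj_eq (@ord_inj _)) /hval /=; apply/eqP/eqP; rewrite /eta; lia.
Qed.

Lemma eta_layer k l : (eta k = eta l) <-> (layer k = layer l).
Proof.
split=> [kl|/eqP]; first by apply: val_inj; rewrite /= kl.
rewrite -eta_hval => /eqP ->; rewrite /hval /=.
have := finset.cardsC (Jset l); rewrite card_ord /eta; lia.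
Qed.

Lemma layer_surj i : exists k, layer k = i.
Proof.
pose J : {set 'I_d} := [set j in take (d - i) (enum 'I_d)]%SET.
have Ji : #|J| = (d - i)%N.
  rewrite cardsE (card_uniqP _) ?take_uniq ?enum_uniq // size_take size_enum_ord.
  by case: ifP => //; lia.
exists (split_index J); apply/eqP; rewrite -eta_hval eta_split_index.
have := finset.cardsC J; rewrite card_ord Ji /hval.
have im : (i < 1 + d./2)%N := ltn_ord i.
lia.
Qed.

Lemma multiplicityE i : multiplicity i = #|[pred k | layer k == i]|.
Proof.
rewrite /multiplicity cardsE; apply: eq_card => k.
by rewrite -[LHS]/(eta k == hval i) eta_hval.
Qed.

Lemma multiplicity_neq0 (R : realType) i : (multiplicity i)%:R != 0 :> R.
Proof.
have [k ki] := layer_surj i.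
by rewrite pnatr_eq0 -lt0n multiplicityE; apply/card_gt0P; exists k; rewrite !inE ki.
Qed.

Lemma bvec_sumE (R : realType) (v : 'I_(msize d) -> R) :
  \sum_i v i *: bvec R i =
  \sum_k (v (layer k) / (multiplicity (layer k))%:R) *: avec R k.
Proof.
rewrite (partition_big layer xpredT) //=; apply: eq_bigr => i _.
rewrite /bvec scalerA scaler_sumr [RHS]big_mkcond /=; apply: eq_bigr => k _.
rewrite eta_hval; case: eqP => [->|_]; first by rewrite scale1r.
by rewrite scale0r scaler0.
Qed.

Lemma bvec_free (R : realType) (c : 'I_(msize d) -> R) :
  \sum_i c i *: bvec R i = 0 -> forall i, c i = 0.
Proof.
rewrite bvec_sumE => /avec_free c0 i; have [k ki] := layer_surj i.
have /eqP := c0 k; rewrite ki mulf_eq0 invr_eq0.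
by rewrite (negbTE (multiplicity_neq0 R i)) orbF => /eqP.
Qed.

Lemma eta_invariant_b_mixtures (R : realType) :
  eta_invariant_mixtures R d = b_mixtures R d.
Proof.
apply/seteqP; split => [_ [w [w0 w1 w_eta ->]]|_ [v [v0 v1 ->]]].
  exists (fun i => \sum_(k | layer k == i) w k); split.
  - by move=> i; apply: sumr_ge0.
  - by rewrite -w1 [RHS](partition_big layer xpredT).
  rewrite bvec_sumE; apply: eq_bigr => k _; congr (_ *: _).
  rewrite (eq_bigr (fun=> w k)); last by move=> l /eqP/eta_layer; exact: w_eta.
  rewrite sumr_const -multiplicityE -[w k *+ _]mulr_natr mulfK //.
  exact: multiplicity_neq0.
exists (fun k => v (layer k) / (multiplicity (layer k))%:R); split.
- by move=> k; rewrite divr_ge0 ?ler0n.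
- rewrite (partition_big layer xpredT) //= -[RHS]v1; apply: eq_bigr => i _.
  rewrite (eq_bigr (fun=> v i / (multiplicity i)%:R)); last by move=> k /eqP ->.
  rewrite sumr_const -multiplicityE -[v i / _ *+ _]mulr_natr divfK //.
  exact: multiplicity_neq0.
- by move=> k l /eta_layer ->.
- exact: bvec_sumE.
Qed.

End Layers.

(** * Convex hulls of finite families *)

Section Mixtures.
Variables (R : realType) (V : lmodType R) (I : finType) (b : I -> V).

Definition mixtures : set V :=
  [set x | exists v : I -> R,
     [/\ forall i, 0 <= v i, \sum_i v i = 1 & x = \sum_i v i *: b i]].

Lemma mixtures_range i : mixtures (b i).
Proof.
exists (fun j => (j == i)%:R); split.
- by move=> j; rewrite ler0n.
- by rewrite (bigD1 i) //= eqxx big1 ?addr0 // => j /negbTE ->.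
- rewrite (bigD1 i) //= eqxx scale1r big1 ?addr0 // => j /negbTE ->.
  by rewrite scale0r.
Qed.

Lemma convex_mixtures : @convex_set R V mixtures.
Proof.
move=> x y t /set_mem[v [v0 v1 ->]] /set_mem[w [w0 w1 ->]]; apply/mem_set.
exists (fun i => t%:num * v i + (1 - t%:num) * w i); split.
- by move=> i; rewrite addr_ge0 // mulr_ge0.
- by rewrite big_split /= -!mulr_sumr v1 w1 !mulr1 addrC subrK.
- under [RHS]eq_bigr do rewrite scalerDl -!scalerA.
  by rewrite big_split /= -!scaler_sumr.
Qed.

(** Convexity only speaks of two points.  Unless its coefficient is 1, the first
point is split off and the other coefficients are rescaled to have sum 1. *)
Lemma convex_set_sum (A : set V) (r : seq I) (v : I -> R) :
  @convex_set R V A -> (forall i, A (b i)) -> (forall i, 0 <= v i) ->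
  \sum_(i <- r) v i = 1 -> A (\sum_(i <- r) v i *: b i).
Proof.
move=> cA Ab; elim: r v => [|i r IHr] v v0.
  by rewrite big_nil => /esym/eqP; rewrite oner_eq0.
rewrite !big_cons => v1.
have vr : \sum_(j <- r) v j = 1 - v i by rewrite -v1 addrC addKr.
have vi1 : v i <= 1 by rewrite -v1 lerDl sumr_ge0.
have [vi|vi] := eqVneq (v i) 1.
  have r0 : \sum_(j <- r) v j *: b j = 0.
    move: vr; rewrite vi subrr => /eqP; rewrite psumr_eq0 // => /allP r0.
    by rewrite big_seq big1 // => j jr; have /eqP -> := r0 j jr; rewrite scale0r.
  by rewrite r0 addr0 vi scale1r.
have vi' : 1 - v i != 0 by rewrite subr_eq0 eq_sym.
pose z := \sum_(j <- r) ((1 - v i)^-1 * v j) *: b j.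
have Az : A z.
  apply: (IHr (fun j => (1 - v i)^-1 * v j)) => [j|].
    by rewrite mulr_ge0 // invr_ge0 subr_ge0.
  by rewrite -mulr_sumr vr mulVf.
have -> : \sum_(j <- r) v j *: b j = (1 - v i) *: z.
  rewrite scaler_sumr; apply: eq_bigr => j _.
  by rewrite scalerA mulrA mulfV // mul1r.
by have /set_mem := cA _ _ (Itv01 (v0 i) vi1) (mem_set (Ab i)) (mem_set Az).
Qed.

Lemma mixtures_convex_hull : mixtures = convex_hull (range b).
Proof.
apply/seteqP; split; last first.
  apply: smallest_sub; first exact: convex_mixtures.
  by move=> _ [i _ <-]; exact: mixtures_range.
move=> _ [v [v0 v1 ->]] A [cA bA]; apply: convex_set_sum => // i.
by apply: bA; exists i.
Qed.

Lemma mixtures_polytope : convex_polytope mixtures.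
Proof.
by exists (range b); [exact: finite_image|exact: mixtures_convex_hull].
Qed.

Hypothesis b_free : forall c : I -> R, \sum_i c i *: b i = 0 -> forall i, c i = 0.

Lemma free_coef (v w : I -> R) :
  \sum_i v i *: b i = \sum_i w i *: b i -> v =1 w.
Proof.
move=> vw i; apply/eqP; rewrite -subr_eq0; apply/eqP; move: i.
apply: b_free; under eq_bigr do rewrite scalerBl.
by rewrite sumrB vw subrr.
Qed.

(** A mixture with a coefficient v_i in the open interval from 0 to 1 lies
strictly between b_i and the mixture of the other points with rescaled
coefficients, so it can only be extreme if it is b_i.  Conversely, if b_i is
strictly between two mixtures, comparing coefficients shows that both give
weight 0 to every b_j with j <> i. *)
Lemma vertices_mixtures : vertices mixtures = range b.
Proof.
apply/seteqP; split => [x [[v [v0 v1 xE]] x_ext]|_ [i _ <-]].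
  have [i vi] : exists i, v i != 0.
    apply/existsP; rewrite -[X in is_true X]negbK negb_exists.
    apply: contraTN (oner_neq0 R) => /forallP v_eq0.
    by rewrite -v1 big1 ?eqxx // => i _; apply/eqP/negbNE.
  exists i => //.
  have vi1 : v i <= 1 by rewrite -v1 (bigD1 i) //= lerDl sumr_ge0.
  have vr : \sum_(j | j != i) v j = 1 - v i by rewrite -v1 [in RHS](bigD1 i) //= [v i + _]addrC addrK.
  have [vi_eq1|vi_neq1] := eqVneq (v i) 1.
    move: vr; rewrite vi_eq1 subrr => /eqP; rewrite psumr_eq0 // => /allP r0.
    rewrite xE (bigD1 i) //= vi_eq1 scale1r big1 ?addr0 // => j ji.
    by have := r0 j (mem_index_enum _); rewrite ji => /eqP ->; rewrite scale0r.
  have vi' : 1 - v i != 0 by rewrite subr_eq0 eq_sym.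
  pose w j := if j == i then 0 else (1 - v i)^-1 * v j.
  have wE (U : nmodType) (g : R -> I -> U) : (forall j, g 0 j = 0) ->
      \sum_j g (w j) j = \sum_(j | j != i) g ((1 - v i)^-1 * v j) j.
    move=> g0; rewrite (bigD1 i) //= /w eqxx g0 add0r.
    by apply: eq_bigr => j /negbTE ->.
  have [||||//] := x_ext (b i) (\sum_j w j *: b j) (v i).
  - exact: mixtures_range.
  - exists w; split => //.
      by move=> j; rewrite /w; case: eqP => // _; rewrite mulr_ge0 // invr_ge0 subr_ge0.
    by rewrite (wE _ (fun c _ => c)) // -mulr_sumr vr mulVf.
  - by rewrite lt_neqAle eq_sym vi v0 lt_neqAle vi_neq1.
  - rewrite (wE _ (fun c j => c *: b j)) => [|j]; last by rewrite scale0r.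
    rewrite xE (bigD1 i) //=; congr (_ + _); rewrite scaler_sumr.
    by apply: eq_bigr => j _; rewrite scalerA mulrA mulfV // mul1r.
split=> [|_ _ t [v [v0 v1 ->]] [w [w0 w1 ->]] /andP[t0 t1] biE].
  exact: mixtures_range.
have t1' : 0 < 1 - t by rewrite subr_gt0.
have vw j : (j == i)%:R = t * v j + (1 - t) * w j.
  move: j; apply: free_coef.
  rewrite [LHS](_ : _ = b i); last first.
    rewrite (bigD1 i) //= eqxx scale1r big1 ?addr0 // => j /negbTE ->.
    by rewrite scale0r.
  under [RHS]eq_bigr do rewrite scalerDl -!scalerA.
  by rewrite big_split /= -!scaler_sumr.
have off j : j != i -> v j = 0 /\ w j = 0.
  move=> ji; have /esym/eqP := vw j; rewrite (negbTE ji).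
  rewrite paddr_eq0 ?mulr_ge0 ?(ltW t0) ?(ltW t1') //.
  by rewrite !mulf_eq0 (gt_eqF t0) (gt_eqF t1') => /andP[/eqP-> /eqP->].
have pure (u : I -> R) : \sum_j u j = 1 -> (forall j, j != i -> u j = 0) ->
    \sum_j u j *: b j = b i.
  move=> u1 u0; have ui : u i = 1.
    by rewrite -u1 (bigD1 i) //= big1 ?addr0 // => j /u0.
  by rewrite (bigD1 i) //= ui scale1r big1 ?addr0 // => j /u0 ->; rewrite scale0r.
by split; apply: pure => // j /off[].
Qed.

End Mixtures.

Lemma free_image (K : fieldType) (V : vectType K) (I : finType) (b : I -> V) :
  (forall c : I -> K, \sum_i c i *: b i = 0 -> forall i, c i = 0) ->
  free [seq b i | i : I].
Proof.
move=> b_free; apply/(@freeP _ _ _ (in_tuple _)) => c c0 j.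
have sz : size [seq b i | i : I] = #|I| by rewrite size_image.
pose h i := cast_ord (esym sz) (enum_rank i).
have hb : bijective h.
  exists (fun j => enum_val (cast_ord sz j)) => x.
    by rewrite /h cast_ordKV enum_rankK.
  by rewrite /h enum_valK cast_ordK.
have [g gK Kg] := hb; rewrite -(Kg j).
apply: (b_free (c \o h)); rewrite -[RHS]c0 (reindex h) /=; last first.
  exact: onW_bij.
apply: eq_bigr => i _; congr (_ *: _).
by rewrite /= (nth_map i) -?cardE ?ltn_ord // nth_enum_rank.
Qed.

(** * The uniform law *)

Lemma eq_measure_off_null (dd : measure_display) (T : measurableType dd)
    (R : realType) (mu : {measure set T -> \bar R}) (N A B : set T) :
  measurable N -> measurable A -> measurable B -> mu N = 0%E ->
  A `\` N = B `\` N -> mu A = mu B.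
Proof.
move=> mN mA mB N0 AB.
rewrite (measureDI mu mA mN) (measureDI mu mB mN) AB.
by congr (_ + _)%E; rewrite !(subset_measure0 _ _ _ N0) //;
  [exact: measurableI|exact: measurableI].
Qed.

Lemma measure_sum_fibers (dd : measure_display) (T : measurableType dd)
    (R : realType) (mu : {measure set T -> \bar R}) (I : finType) (h : T -> I)
    (A : set T) :
  measurable A -> (forall i, measurable (h @^-1` [set i])) ->
  mu A = (\sum_i mu (A `&` h @^-1` [set i]))%E.
Proof.
move=> mA mh.
have {1}-> : A = \bigcup_(i in [set` index_enum I]) (A `&` h @^-1` [set i]).
  apply/seteqP; split => [x Ax|x [i _ []//]].
  by exists (h x) => //=; exact: mem_index_enum.
rewrite measure_fin_bigcup //.
- by rewrite -fsbig_seq ?index_enum_uniq.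
- by move=> i j _ _ [x [[_ /= <-] [_ /= <-]]].
- by move=> i _; exact: measurableI.
Qed.

Section Uniform.
Variable R : realType.
Local Notation lambda := (@lebesgue_measure R).
Local Notation unif := (uniform_prob (@ltr01 R)).

Lemma measurable_reflection : measurable_fun [set: R] (fun x : R => 1 - x).
Proof. exact: measurable_funB. Qed.

Lemma uniform_probE (A : set R) : measurable A -> unif A = lambda (A `&` `[0, 1]).
Proof.
move=> mA; rewrite /uniform_prob integral_uniform_pdf.
rewrite (eq_integral (fun=> 1%:E)); last first.
  move=> x; rewrite inE => -[_]; rewrite /= in_itv /= /uniform_pdf => ->.
  by rewrite subr0 invr1.
by rewrite integral_cst ?mul1e //; apply: measurableI.
Qed.

Lemma lebesgue_measure_reflection (A : set R) : measurable A ->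
  pushforward lambda ((fun x => 1 - x) : _ -> measurableTypeR R) A = lambda A.
Proof.
move=> mA; apply/esym/lebesgue_measure_unique => //=.
  exact: measurable_reflection.
move=> mr _ [[a b]] _ <-.
rewrite /pushforward /=.
have -> : (fun x : R => 1 - x) @^-1` `]a, b] = `[1 - b, 1 - a[%classic.
  apply/seteqP; split => x; rewrite /= !in_itv /=; lra.
rewrite !lebesgue_measure_itv /= !lte_fin ltrD2l ltrN2.
by case: ifP => // _; rewrite -!EFinB; congr EFin; lra.
Qed.

Lemma uniform_prob_reflection (A : set R) : measurable A ->
  unif ((fun x => 1 - x) @^-1` A) = unif A.
Proof.
move=> mA; have mfA : measurable ((fun x : R => 1 - x) @^-1` A).
  by rewrite -[X in measurable X]setTI; exact: measurable_reflection.
rewrite !uniform_probE // -[RHS]lebesgue_measure_reflection; last exact: measurableI.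
congr lebesgue_measure; apply/seteqP; split => x; rewrite /= !in_itv /= => -[Ax];
  split => //; lra.
Qed.

Lemma uniform_prob_point (r : R) : unif [set r] = 0%E.
Proof.
rewrite uniform_probE; last exact: measurable_set1.
apply: (subset_measure0 _ _ _ (lebesgue_measure_set1 r)) => //.
by apply: measurableI => //; exact: measurable_set1.
Qed.

End Uniform.

(** * The signature of a law with uniform margins *)

Section Concordance.
Variables (R : realType) (d : nat) (mu : probability (d.-tuple R) R).
Hypothesis mu_unif : uniform_margins mu.
Implicit Types (I J : {set 'I_d}).

Definition order_pattern (p : d.-tuple R * d.-tuple R) : {set 'I_d} :=
  [set j | tnth p.1 j < tnth p.2 j]%SET.

Definition tied : set (d.-tuple R * d.-tuple R) :=
  \bigcup_(j in [set: 'I_d]) [set p | tnth p.1 j = tnth p.2 j].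

Lemma measurable_coordinate_le (j : 'I_d) (f g : d.-tuple R * d.-tuple R -> d.-tuple R) :
  measurable_fun setT f -> measurable_fun setT g ->
  measurable [set p | tnth (f p) j <= tnth (g p) j].
Proof.
move=> mf mg; rewrite -[X in measurable X]setTI.
by apply: measurable_fun_le => //;
  apply: (measurableT_comp (@measurable_tnth _ _ _ j)).
Qed.

Lemma measurable_tie (j : 'I_d) :
  measurable [set p : d.-tuple R * d.-tuple R | tnth p.1 j = tnth p.2 j].
Proof.
rewrite (_ : [set _ | _] = [set p : d.-tuple R * d.-tuple R | tnth p.1 j <= tnth p.2 j] `&`
    [set p : d.-tuple R * d.-tuple R | tnth p.2 j <= tnth p.1 j]).
  by apply: measurableI; apply: measurable_coordinate_le.
apply/seteqP; split => p /=; first by move=> ->.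
by case=> pq qp; apply/le_anti; rewrite pq qp.
Qed.

(** Given the first vector, a tie in coordinate j means that coordinate j of the
second one takes a prescribed value, which has uniform probability 0. *)
Lemma tie_null (j : 'I_d) :
  (mu \x mu)%E [set p : d.-tuple R * d.-tuple R | tnth p.1 j = tnth p.2 j] = 0%E.
Proof.
rewrite /product_measure1; apply: integral0_eq => x _ /=.
rewrite (_ : xsection _ _ = (fun y : d.-tuple R => tnth y j) @^-1` [set tnth x j]).
  have := mu_unif j (measurable_set1 (tnth x j)); rewrite /pushforward => ->.
  exact: uniform_prob_point.
by apply/seteqP; split => y; rewrite /xsection /= inE /= => ->.
Qed.

Lemma tiedE : tied = \big[setU/set0]_(j : 'I_d)
  [set p : d.-tuple R * d.-tuple R | tnth p.1 j = tnth p.2 j].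
Proof.
rewrite -bigcup_seq /tied; congr (bigcup _ _); apply/seteqP; split => j //= _.
exact: mem_index_enum.
Qed.

Lemma measurable_tied : measurable tied.
Proof. by rewrite tiedE; apply: bigsetU_measurable => j _; exact: measurable_tie. Qed.

Lemma tied_null : (mu \x mu)%E tied = 0%E.
Proof.
apply: measure_negligible; first exact: measurable_tied.
rewrite tiedE; apply: (big_ind (fun A => (mu \x mu)%E.-negligible A)).
- exact: negligible_set0.
- by move=> A B; exact: negligibleU.
- by move=> j _; apply/negligibleP; [exact: measurable_tie|exact: tie_null].
Qed.

Lemma measurable_order_pattern J : measurable (order_pattern @^-1` [set J]).
Proof.
rewrite (_ : _ @^-1` _ = \bigcap_(j in [set: 'I_d])
    (if j \in J then ~` [set p : d.-tuple R * d.-tuple R | tnth p.2 j <= tnth p.1 j]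
     else [set p : d.-tuple R * d.-tuple R | tnth p.2 j <= tnth p.1 j])).
  apply: fin_bigcap_measurable => // j _; case: ifP => _; last exact: measurable_coordinate_le.
  by apply: measurableC; exact: measurable_coordinate_le.
apply/seteqP; split => p /=.
  move=> <- j _; rewrite inE; case: ltP => //=.
  by move=> pj /=; apply/negP; rewrite -ltNge.
move=> pJ; apply/setP => j; rewrite inE; have := pJ j Logic.I.
case: ifP => _ /=; first by move/negP; rewrite -ltNge.
by rewrite leNgt => /negbTE.
Qed.

Definition pattern_prob J : R := fine ((mu \x mu)%E (order_pattern @^-1` [set J])).

Lemma pattern_probE J : (pattern_prob J)%:E = (mu \x mu)%E (order_pattern @^-1` [set J]).
Proof.
rewrite /pattern_prob fineK //.
exact: (fin_num_measure ((mu \x mu)%E : probability _ R)) (measurable_order_pattern J).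
Qed.

Lemma pattern_prob_ge0 J : 0 <= pattern_prob J.
Proof. by rewrite -lee_fin pattern_probE. Qed.

Lemma pattern_prob_sum : \sum_J pattern_prob J = 1.
Proof.
apply: EFin_inj; rewrite -sumEFin -(probability_setT ((mu \x mu)%E : probability _ R)).
rewrite (@measure_sum_fibers _ _ _ (mu \x mu)%E _ order_pattern) //; last first.
  exact: measurable_order_pattern.
by apply: eq_bigr => J _; rewrite setTI pattern_probE.
Qed.

Lemma concordant_pattern I (p : d.-tuple R * d.-tuple R) :
  ~ tied p -> concordant R I p <-> same_side I (order_pattern p).
Proof.
move=> p_untied; have untied j : tnth p.1 j != tnth p.2 j.
  by apply/eqP => pj; apply: p_untied; exists j.
rewrite /same_side; split.
  case=> Ip; apply/orP; [left|right]; apply/fintype.subsetP => j jI.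
    by rewrite inE lt_neqAle untied Ip.
  by rewrite !inE -leNgt Ip.
case/orP => /fintype.subsetP Ip; [left|right] => j jI; have := Ip j jI.
  by rewrite inE => /ltW.
by rewrite !inE -leNgt.
Qed.

(** Split the event of concordance according to the order pattern J; up to ties,
each part is the whole event that the pattern is J if I is on one side of J,
and is empty otherwise. *)
Lemma law_kappa_pattern I : ~~ odd #|I| ->
  law_kappa mu I = \sum_J pattern_prob J * (same_side I J)%:R.
Proof.
move=> evI; rewrite /law_kappa; case: ifP => [I1|_].
  rewrite -[LHS]pattern_prob_sum; apply: eq_bigr => J _.
  by rewrite same_side_small // mulr1.
have mI := measurable_concordant (R := R) I.
apply: EFin_inj; rewrite fineK; last exact: (fin_num_measure ((mu \x mu)%E : probability _ R)).
rewrite (@measure_sum_fibers _ _ _ (mu \x mu)%E _ order_pattern) //; last first.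
  exact: measurable_order_pattern.
rewrite -sumEFin; apply: eq_bigr => J _; rewrite EFinM pattern_probE.
have mJ := measurable_order_pattern J.
case sIJ : (same_side I J); rewrite ?mule1 ?mule0.
  apply: (eq_measure_off_null measurable_tied) => //; first exact: measurableI.
    exact: tied_null.
  apply/seteqP; split => p /=; first by move=> [[]].
  move=> [pJ p_tied]; split=> //; split => //.
  by apply/concordant_pattern => //; rewrite pJ.
apply: subset_measure0 (tied_null); first exact: measurableI.
- exact: measurable_tied.
- move=> p [Ip pJ]; apply: contrapT => p_tied.
  by move/(concordant_pattern I p_tied): Ip; rewrite pJ sIJ.
Qed.

End Concordance.

(** * Mixtures of extremal laws *)

Lemma finite_mixture (dd : measure_display) (T : measurableType dd)
    (R : realType) (N : nat) (m : 'I_N -> probability T R) (w : 'I_N -> R) :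
  (forall k, 0 <= w k) -> \sum_k w k = 1 ->
  exists mu : probability T R,
    (forall A, mu A = \sum_k (w k)%:E * m k A)%E /\
    (forall f : T -> \bar R, measurable_fun setT f -> (forall x, 0 <= f x)%E ->
      \int[mu]_x f x = \sum_k (w k)%:E * \int[m k]_x f x)%E.
Proof.
move=> w0 w1; have [k0 _] : exists k0 : 'I_N, true.
  apply/existsP; apply: contraTT (oner_neq0 R); rewrite negb_exists => /forallP noN.
  by rewrite negbK -w1 big1 // => k; have := noN k.
(* Sums of measures are taken along sequences indexed by nat, of which only the
   first N terms matter here. *)
pose idx (i : nat) := odflt k0 (insub i).
have idxK (k : 'I_N) : idx k = k by rewrite /idx valK.
pose m_ (i : nat) : {measure set T -> \bar R} :=
  mscale (NngNum (w0 (idx i))) (m (idx i)).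
have mE A : msum m_ N A = (\sum_k (w k)%:E * m k A)%E.
  by apply: eq_bigr => k _; rewrite /= /mscale /= idxK.
have mT : msum m_ N setT = 1%E.
  rewrite mE -[in RHS]w1 -sumEFin; apply: eq_bigr => k _.
  by rewrite probability_setT mule1.
pose mu : probability T R :=
  HB.pack (msum m_ N) (Measure_isProbability.Build _ _ _ (msum m_ N) mT).
exists mu; split; first exact: mE.
move=> f mf f0; rewrite /= ge0_integral_measure_sum //.
apply: eq_bigr => k _; rewrite /= ge0_integral_mscale //.
by rewrite /= idxK.
Qed.

Section ExtremalLaws.
Variables (R : realType) (d : nat).
Implicit Types (I J L : {set 'I_d}) (x y : R).
Local Notation unif := (uniform_prob (@ltr01 R)).

(** A parametrization of the support of the extremal copula of J: under the uniform law of x, the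
coordinates in J are all equal to x and the other ones to 1 - x. *)
Definition extremal_point J (x : measurableTypeR R) : d.-tuple R :=
  [tuple if j \in J then (x : R) else 1 - (x : R) | j < d].

Lemma measurable_extremal_point J : measurable_fun setT (extremal_point J).
Proof.
apply/measurable_fun_tnthP => j.
rewrite (_ : _ \o _ = if j \in J then id else fun x : R => 1 - x).
  by case: ifP => _; [exact: measurable_id|exact: measurable_reflection].
by apply/funext => x /=; rewrite tnth_mktuple; case: ifP.
Qed.

HB.instance Definition _ J :=
  isMeasurableFun.Build _ _ _ _ (extremal_point J) (measurable_extremal_point J).

Definition extremal_law J : probability (d.-tuple R) R :=
  distribution unif (extremal_point J).

Lemma extremal_law_margin J (j : 'I_d) (A : set R) : measurable A ->
  extremal_law J ((fun z : d.-tuple R => tnth z j) @^-1` A) = unif A.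
Proof.
move=> mA; rewrite /extremal_law /= /distribution /pushforward /=.
case jJ : (j \in J).
  by congr (uniform_prob _ _); apply/seteqP; split => x; rewrite /= tnth_mktuple jJ.
rewrite -[RHS]uniform_prob_reflection //.
by congr (uniform_prob _ _); apply/seteqP; split => x; rewrite /= tnth_mktuple jJ.
Qed.

Lemma concordant_swap I (p q : d.-tuple R) :
  concordant R I (p, q) <-> concordant R I (q, p).
Proof. by split; case=> pq; [right|left|right|left]. Qed.

(** Measured from the centre 1/2, the coordinates of the first point are plus or
minus x - 1/2, with the sign given by J, and those of the second point are
smaller in absolute value.  So the sign decides each comparison, whatever L
is. *)
Lemma concordant_dominant I J L x y : `|y - 2^-1| < `|x - 2^-1| ->
  concordant R I (extremal_point J x, extremal_point L y) <-> same_side I J.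
Proof.
move=> yx; have [low bnd] : exists low : bool,
    if low then [/\ x < y, x < 1 - y, y < 1 - x & 1 - y < 1 - x]
    else [/\ y < x, 1 - y < x, 1 - x < y & 1 - x < 1 - y].
  exists (x < 2^-1); case: ltP => x2; move: yx.
    by rewrite [X in _ < X]ltr0_norm ?subr_lt0 // ltr_norml => /andP[? ?]; split; lra.
  by rewrite [X in _ < X]ger0_norm ?subr_ge0 // ltr_norml => /andP[? ?]; split; lra.
(* low tells whether x is below the centre; then the first point is below the
   second one exactly at the coordinates in J. *)
have le1 j : (tnth (extremal_point J x) j <= tnth (extremal_point L y) j) =
    ((j \in J) == low).
  rewrite !tnth_mktuple; move: bnd; case: (low) => -[? ? ? ?];
  case: (j \in J); case: (j \in L) => /=; rewrite ?eqxx /=;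
  first [by apply/idP; lra | by apply/negbTE; rewrite -ltNge; lra].
have le2 j : (tnth (extremal_point L y) j <= tnth (extremal_point J x) j) =
    ((j \in J) != low).
  rewrite !tnth_mktuple; move: bnd; case: (low) => -[? ? ? ?];
  case: (j \in J); case: (j \in L) => /=; rewrite ?eqxx /=;
  first [by apply/idP; lra | by apply/negbTE; rewrite -ltNge; lra].
have sub_leJ b : (forall j, j \in I -> (j \in J) = b) <->
    (if b then I \subset J else I \subset ~: J)%SET.
  case: b; split => [IJ|/fintype.subsetP IJ j /IJ].
  - by apply/fintype.subsetP => j /IJ.
  - by [].
  - by apply/fintype.subsetP => j /IJ; rewrite inE => ->.
  - by rewrite inE => /negbTE.
have -> : concordant R I (extremal_point J x, extremal_point L y) =
    ((forall j, j \in I -> (j \in J) = low) \/ (forall j, j \in I -> (j \in J) = ~~ low)).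
  rewrite /concordant /setU /mkset /sub_le /=; congr (_ \/ _); apply/propext; split => H j jI.
  - by have := H j jI; rewrite le1 => /eqP.
  - by rewrite le1; apply/eqP/H.
  - by have := H j jI; rewrite le2; case: (j \in J); case: (low).
  - by rewrite le2 (H j jI); case: (low).
rewrite /same_side; split.
  by case=> /sub_leJ; case: (low) => /= ->; rewrite ?orbT.
by case/orP => IJ; case: (boolP low) => lw; [left|right|right|left]; apply/sub_leJ.
Qed.

Lemma equidistant_null x : unif [set y | `|y - 2^-1| = `|x - 2^-1|] = 0%E.
Proof.
rewrite (_ : [set _ | _] = [set x] `|` [set 1 - x]).
  rewrite (@measureU0 _ _ _ unif [set x] [set 1 - x]) //; exact: uniform_prob_point.
apply/seteqP; split => y /=; last first.
  case=> ->; first by [].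
  by rewrite (_ : 1 - x - 2^-1 = - (x - 2^-1)) ?normrN //; lra.
case: (ger0P (y - 2^-1)) => _; case: (ger0P (x - 2^-1)) => _ e;
  first [by left; lra|by right; lra].
Qed.

Lemma measurable_center_dist : measurable_fun setT (fun y : R => `|y - 2^-1|).
Proof.
apply: measurableT_comp; first exact: normr_measurable.
exact: measurable_funB.
Qed.

(** The probability that an independent uniform draw is nearer to the centre
than x. *)
Definition central_prob x : R := fine (unif [set y | `|y - 2^-1| < `|x - 2^-1|]).

Lemma concordant_section_prob I J L x :
  unif [set y | concordant R I (extremal_point J x, extremal_point L y)] =
  ((same_side I J)%:R * central_prob x + (same_side I L)%:R * (1 - central_prob x))%:E.
Proof.
set S := [set y | concordant _ _ _]; pose B := [set y : R | `|y - 2^-1| < `|x - 2^-1|].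
set E := [set y : R | `|y - 2^-1| = `|x - 2^-1|].
have mB : measurable B.
  rewrite (_ : B = ~` [set y | `|x - 2^-1| <= `|y - 2^-1|]).
    apply: measurableC; rewrite -[X in measurable X]setTI.
    by apply: measurable_fun_le => //; exact: measurable_center_dist.
  by apply/seteqP; split => y; rewrite /B /= ltNge => /negP.
have mE : measurable E.
  by have := measurable_center_dist measurableT (measurable_set1 `|x - 2^-1|); rewrite setTI.
have mS : measurable S.
  have := measurable_xsection (extremal_point J x) (measurable_concordant (R := R) I).
  move/(measurable_extremal_point L measurableT); rewrite setTI.
  rewrite (_ : _ @^-1` _ = S) //.
  by apply/seteqP; split => y; rewrite /S /xsection /= inE.
have gE : (central_prob x)%:E = unif B by rewrite fineK // fin_num_measure.
rewrite EFinD !EFinM EFinB gE (measureDI unif mS mB) [LHS]addeC; congr (_ + _)%E.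
  case sIJ : (same_side I J); rewrite ?mul1e ?mul0e.
    congr (uniform_prob _ _); apply/seteqP; split => y [] //= yB.
    by split=> //; apply/(concordant_dominant I J L yB).
  rewrite (_ : _ `&` _ = set0) ?measure0 //; apply/seteqP; split => y //= -[Sy yB].
  by move/(concordant_dominant I J L yB): Sy; rewrite sIJ.
rewrite -(probability_setC unif mB).
have dominantL y : ~ B y -> ~ E y ->
    concordant R I (extremal_point J x, extremal_point L y) <-> same_side I L.
  move=> yB yE; apply: (iff_trans (concordant_swap _ _ _)).
  apply: concordant_dominant; rewrite lt_neqAle eq_sym.
  by apply/andP; split; [apply/eqP|rewrite leNgt; apply/negP].
case sIL : (same_side I L); rewrite ?mul1e ?mul0e.
  apply: (@eq_measure_off_null _ _ _ unif E) => //.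
  - exact: measurableD.
  - exact: measurableC.
  - exact: equidistant_null.
  apply/seteqP; split => y [] => [[Sy yB] yE //|yB yE].
  by split=> //; split => //; apply/(dominantL y yB yE).
apply: (@subset_measure0 _ _ _ unif _ E) => //.
- exact: measurableD.
- move=> y [Sy yB]; apply: contrapT => yE.
  by move/(dominantL y yB yE): Sy; rewrite sIL.
- exact: equidistant_null.
Qed.

(** The proof integrates first over the second draw.  For a fixed first draw
(k, x), with g(x) = [central_prob x], the probability of concordance is
a_{I,k} g(x) + kap (1 - g(x)), where kap is the sum of the w_k a_{I,k}.  Its
mean over k is kap for every x, so g is never computed. *)
Lemma mixture_law (N : nat) (K : 'I_N -> {set 'I_d}) (w : 'I_N -> R) :
  (forall k, 0 <= w k) -> \sum_k w k = 1 ->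
  exists mu : probability (d.-tuple R) R, uniform_margins mu /\
    forall I, ~~ odd #|I| -> law_kappa mu I = \sum_k w k * (same_side I (K k))%:R.
Proof.
move=> w0 w1; have [mu [muE mu_int]] := finite_mixture (fun k => extremal_law (K k)) w0 w1.
exists mu; split => [j A mA|I evI].
  rewrite /pushforward muE.
  under eq_bigr do rewrite extremal_law_margin //.
  rewrite -ge0_sume_distrl; first by rewrite sumEFin w1 mul1e.
  by move=> k _; rewrite lee_fin.
rewrite /law_kappa; case: ifP => [I1|_].
  rewrite -[LHS]w1; apply: eq_bigr => k _.
  by rewrite same_side_small // mulr1.
set kap := RHS; pose A := concordant R I.
have mA : measurable A by exact: measurable_concordant.
have muA k x : mu (xsection A (extremal_point (K k) x)) =
    ((same_side I (K k))%:R * central_prob x + kap * (1 - central_prob x))%:E.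
  rewrite muE /extremal_law /=.
  under eq_bigr => l _.
    rewrite /distribution /pushforward (_ : _ @^-1` _ =
      [set y | concordant R I (extremal_point (K k) x, extremal_point (K l) y)]).
      rewrite concordant_section_prob -EFinM mulrDr !mulrA; over.
    by apply/seteqP; split => y; rewrite /xsection /= inE.
  by rewrite sumEFin big_split /= -!mulr_suml w1 mul1r.
have mfx : measurable_fun setT (mu \o xsection A) by exact: measurable_fun_xsection.
rewrite /product_measure1 mu_int //.
have -> : (\sum_k (w k)%:E * \int[extremal_law (K k)]_x (mu \o xsection A) x =
    \int[unif]_x \sum_k (w k)%:E * mu (xsection A (extremal_point (K k) x)))%E.
  have mk k : measurable_fun setT (fun x => mu (xsection A (extremal_point (K k) x))).
    exact: (measurableT_comp mfx (measurable_extremal_point (K k))).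
  rewrite ge0_integral_sum //; last first.
  - by move=> k x _; apply: mule_ge0; [rewrite lee_fin|exact: measure_ge0].
  - by move=> k; apply: measurable_funeM; exact: mk.
  apply: eq_bigr => k _; rewrite ge0_integralZl ?lee_fin //; last exact: mk.
  by rewrite /extremal_law /= /distribution ge0_integral_pushforward.
rewrite (eq_integral (fun=> kap%:E)); last first.
  move=> x _; under eq_bigr do rewrite muA -EFinM mulrDr mulrA.
  rewrite sumEFin big_split /= -!mulr_suml -/kap w1; congr EFin; ring.
by rewrite integral_cst //= probability_setT mule1.
Qed.

End ExtremalLaws.

(** * Attainable signatures *)

Section Attainability.
Variables (R : realType) (n : nat).
Local Notation d := n.+1.

Lemma mixture_signatureE (w : 'I_(2 ^ d.-1) -> R) (I : even_set d) :
  (\sum_k w k *: avec R k) I = \sum_k w k * (same_side (val I) (Jset k))%:R.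
Proof. by rewrite sum_ffunE; apply: eq_bigr => k _; rewrite ffunE avecE. Qed.

(** The patterns J and its complement select the same subsets I, so their
probabilities are added. *)
Lemma attainable_sub_mixtures :
  attainable_equiconcordant R d `<=` eta_invariant_mixtures R d.
Proof.
move=> _ [C [[mu [muC mu_unif]] C_equi ->]].
pose v J := pattern_prob mu J + pattern_prob mu (~: J)%SET.
have kappa_v (I : {set 'I_d}) : ~~ odd #|I| ->
    kappa C I = \sum_k v (Jset k) * (same_side I (Jset k))%:R.
  move=> evI; rewrite (kappaE I muC) law_kappa_pattern // sum_Jset.
  by apply: eq_bigr => k _; rewrite same_sideC -mulrDl.
have [||I I' evI II'|w [w0 w1 w_eta vw]] := @symmetrized_weights n R v.
- by move=> J; rewrite addr_ge0 ?pattern_prob_ge0.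
- by move=> J; rewrite /v finset.setCK addrC.
- have evI' : ~~ odd #|I'| by rewrite -II'.
  rewrite -!kappa_v //.
  exact: (C_equi (exist _ I evI) (exist _ I' evI')).
exists w; split => //.
  by rewrite w1 -(sum_Jset (pattern_prob mu)) pattern_prob_sum.
apply/ffunP => I; rewrite mixture_signatureE ffunE.
by rewrite kappa_v ?vw //; exact: (valP I).
Qed.

Lemma mixtures_sub_attainable :
  eta_invariant_mixtures R d `<=` attainable_equiconcordant R d.
Proof.
move=> _ [w [w0 w1 w_eta ->]].
have [mu [mu_unif mu_kappa]] := mixture_law (@Jset d) w0 w1.
pose C u := fine (mu (orthant u)).
have muC : has_cdf mu C.
  move=> u; rewrite fineK // fin_num_measure // measurable_tuple_orthant.
  by apply: sub_sigma_algebra; exists u.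
exists C; split; first by exists mu.
- move=> I I' II'; rewrite !(kappaE _ muC) !mu_kappa; [|exact: (valP I')|exact: (valP I)].
  exact: mixture_card_invariant.
- apply/ffunP => I; rewrite mixture_signatureE ffunE (kappaE _ muC) mu_kappa //.
  exact: (valP I).
Qed.

End Attainability.

Theorem mainTheorem7 (R : realType) (d : nat) (hd : (2 <= d)%N) :
  [/\ attainable_equiconcordant R d = eta_invariant_mixtures R d,
      eta_invariant_mixtures R d = b_mixtures R d,
      free [seq bvec R i | i : 'I_(msize d)],
      convex_polytope (attainable_equiconcordant R d)
    & vertices (attainable_equiconcordant R d) = range (@bvec R d)].
Proof.
case: d hd => [//|n] _.
have att : attainable_equiconcordant R n.+1 = eta_invariant_mixtures R n.+1.
  by apply/seteqP; split; [exact: attainable_sub_mixtures|exact: mixtures_sub_attainable].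
have etab := eta_invariant_b_mixtures n R.
rewrite att etab; split=> //.
- exact: free_image (@bvec_free n R).
- exact: (mixtures_polytope (@bvec R n.+1)).
- exact: vertices_mixtures (@bvec_free n R).
Qed.
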